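(* Let $\mathcal{C}$ be a finite set, let $\mathbf{v}=(v_i)_{i\in\mathcal{C}}$ be a family of primitive elements $v_i$ of the completed planar Grossman--Larson algebra $\overline{\mathcal{OF}^{\mathcal{C}}}$ (i.e. $v_i$ lies in the completion of $Lie(\mathcal{PT}^{\mathcal{C}})$), with associated character $e^{\mathbf{v}}$ over $\mathcal{S}(Lie(\mathcal{PT}^{\mathcal{C}})\times\mathcal{C})$, and let $\xi$ be a character over $T(\mathcal{PT}^{\mathcal{C}})$, i.e. a group-like element $\xi\in\overline{\mathcal{OF}^{\mathcal{C}}}$ with constant term $1$. Let $\rho_T$ and $\rho_{\triangleright}$ be the coactions dual to the post-Lie translation $T_{\mathbf v}$ and to the grafting product $\triangleright$. Suppose that $$\langle e^{\mathbf{v}}\otimes A,\rho_T(x)\rangle=\langle\xi\otimes A,\rho_{\triangleright}(x)\rangle$$ for all group-like $A\in\mathcal{G}_{\odot}\subset\overline{\mathcal{OF}^{\mathcal{C}}}$ and all $x\in\mathcal{OF}^{\mathcal{C}}$ (equivalently, $T_{\mathbf{v}}(A)=\xi\triangleright A$ for all group-like $A$). Then $e^{\mathbf{v}}=\xi=1$, i.e. $\mathbf{v}=0$ and $\xi=1$.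
   Context: Base field of characteristic zero. $\mathcal{PT}^{\mathcal C}$: vector space spanned by planar rooted trees with vertices decorated by $\mathcal C$. $\mathcal{OF}^{\mathcal C}$: vector space spanned by ordered forests (words of such trees, including the empty forest $1$), with concatenation product, graded by number of vertices; it is the universal enveloping algebra of the free Lie algebra $Lie(\mathcal{PT}^{\mathcal C})$, with unshuffle coproduct $\Delta_{\sqcup\!\sqcup}$ (trees are primitive). $T(\mathcal{PT}^{\mathcal C})=(\mathcal{OF}^{\mathcal C},\cdot,\Delta_{\sqcup\!\sqcup})$. $\overline{\mathcal{OF}^{\mathcal C}}$ is the completion with respect to the grading, all operations being extended continuously; it is paired with $\mathcal{OF}^{\mathcal C}$ by declaring forests to be orthonormal. $A$ is group-like if $\Delta_{\sqcup\!\sqcup}(A)=A\otimes A$ and its constant term is $1$; $\mathcal G_{\odot}$ is the group of group-like elements under concatenation. Left grafting: $\omega_1\triangleright\omega_2$ is the sum over all ways of grafting each root of $\omega_1$ onto a vertex of $\omega_2$, leftmost among the branches already at that vertex, where roots of $\omega_1$ grafted onto the same vertex keep their order; $1\triangleright\omega=\omega$. With this product $(Lie(\mathcal{PT}^{\mathcal C}),\triangleright,[\cdot,\cdot])$ is the free post-Lie algebra on $\mathcal C$ (generators: the single-vertex trees $\bullet_i$, $i\in\mathcal C$). Planar Grossman--Larson product: $A\ast B=A_{(1)}\cdot(A_{(2)}\triangleright B)$. The coaction $\rho_{\triangleright}$ is defined by $\langle A\triangleright B,x\rangle=\langle A\otimes B,\rho_{\triangleright}(x)\rangle$. Post-Lie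 translation: $T_{\mathbf v}:\overline{\mathcal{OF}^{\mathcal C}}\to\overline{\mathcal{OF}^{\mathcal C}}$ is defined by $T_{\mathbf v}(\bullet_i)=\bullet_i+v_i$, extended to (the completion of) $Lie(\mathcal{PT}^{\mathcal C})$ as a continuous post-Lie algebra morphism, and then to $\overline{\mathcal{OF}^{\mathcal C}}$ as a continuous algebra morphism for $\ast$ (it is then also a morphism for concatenation and for $\triangleright$). The character $e^{\mathbf v}$ is $\exp(\sum_{i}(v_i,\bullet_i))$ in the (completed) free commutative cocommutative Hopf algebra $\mathcal S(Lie(\mathcal{PT}^{\mathcal C})\times\mathcal C)$, and $\rho_T:\mathcal{OF}^{\mathcal C}\to\mathcal S(Lie(\mathcal{PT}^{\mathcal C})\times\mathcal C)\otimes\mathcal{OF}^{\mathcal C}$ is the dual coaction, characterised by $\langle T_{\mathbf v}(A),x\rangle=\langle e^{\mathbf v}\otimes A,\rho_T(x)\rangle$. The statement $e^{\mathbf v}=1$ means $v_i=0$ for all $i$. *)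

(* Defs.v *)
From HB Require Import structures.
From mathcomp Require Import all_boot all_order all_algebra finmap zify.
From mathcomp.multinomials Require Export monalg.

Set Implicit Arguments.
Unset Strict Implicit.
Unset Printing Implicit Defensive.

Import GRing.Theory.
Local Open Scope ring_scope.

(* Planar rooted trees with vertices decorated by C: the branches at a vertex  *)
(* are listed from left to right.                                              *)
Inductive tree (C : Type) : Type := Node : C -> seq (tree C) -> tree C.
Arguments Node {C} c s.

Definition leaf (C : Type) (c : C) : tree C := Node c [::].

Section TreeChoice.
Variable C : choiceType.

Fixpoint tree_code (t : tree C) : GenTree.tree C :=
  let: Node c s := t in GenTree.Node 0 (GenTree.Leaf c :: map tree_code s).

Fixpoint tree_decode (u : GenTree.tree C) : option (tree C) :=
  match u with
  | GenTree.Node _ (GenTree.Leaf c :: s) => Some (Node c (pmap tree_decode s))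
  | _ => None
  end.

Lemma tree_codeK : pcancel tree_code tree_decode.
Proof.
rewrite /pcancel; fix IH 1; case=> c s /=; congr (Some (Node c _)).
by elim: s => //= t s ->; rewrite IH.
Qed.

HB.instance Definition _ := Equality.copy (tree C) (pcan_type tree_codeK).
HB.instance Definition _ := Choice.copy (tree C) (pcan_type tree_codeK).
End TreeChoice.

Definition forest (C : Type) : Type := seq (tree C).

(* Concatenation makes forests the free monoid on trees, so that               *)
(* {malg K[forest C]} is the tensor algebra on the span of the trees.          *)
Section ForestMonoid.
Variable C : choiceType.

HB.instance Definition _ := Choice.on (forest C).

Lemma forest_unitm (x y : forest C) : x ++ y = [::] -> x = [::] /\ y = [::].
Proof. by case: x. Qed.

HB.instance Definition _ := Choice_isMonomialDef.Build (forest C)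
  (@catA (tree C)) (@cat0s (tree C)) (@cats0 (tree C)) forest_unitm.
End ForestMonoid.

Fixpoint tdeg (C : Type) (t : tree C) : nat :=
  let: Node _ s := t in (sumn (map (@tdeg C) s)).+1.

Definition fdeg (C : Type) (w : forest C) : nat := sumn (map (@tdeg C) w).

(* All ways of distributing the letters of a word over two subwords; as a sum  *)
(* over the resulting list this is the unshuffle coproduct of the word.        *)
Fixpoint unshuffle (T : Type) (w : seq T) : seq (seq T * seq T) :=
  if w is t :: w' then
    [seq (t :: p.1, p.2) | p <- unshuffle w'] ++
    [seq (p.1, t :: p.2) | p <- unshuffle w']
  else [:: ([::], [::])].

(* graft w f below lists, with multiplicity, one forest for each map from the  *)
(* roots of w to the vertices of f: the trees of w are distributed over the    *)
(* trees of f and, inside a tree, between its root (where they become the      *)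
(* leftmost branches, in their order) and its branches.                        *)
Fixpoint graft_tree (C : Type) (t : tree C) (w : forest C) : seq (tree C) :=
  let: Node c s := t in
  let graft_branches := fix gf (s : seq (tree C)) (w : forest C) :=
    if s is t' :: s' then
      flatten [seq [seq u :: f | u <- graft_tree t' p.1, f <- gf s' p.2]
              | p <- unshuffle w]
    else if w is [::] then [:: [::]] else [::] in
  [seq Node c (p.1 ++ f) | p <- unshuffle w, f <- graft_branches s p.2].

Fixpoint graft (C : Type) (w f : forest C) : seq (forest C) :=
  if f is t :: f' then
    flatten [seq [seq u :: g | u <- graft_tree t p.1, g <- graft p.2 f']
            | p <- unshuffle w]
  else if w is [::] then [:: [::]] else [::].

Section Enumeration.
Variable C : finType.

Definition next_forests (tab : seq (seq (forest C))) : seq (forest C) :=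
  let n := (size tab).-1 in
  [seq Node c sf.1 :: sf.2
  | c <- enum C,
    sf <- flatten [seq [seq (s, f) | s <- nth [::] tab k, f <- nth [::] tab (n - k)]
                  | k <- iota 0 n.+1]].

Fixpoint forest_table (n : nat) : seq (seq (forest C)) :=
  if n is n'.+1 then
    let tab := forest_table n' in rcons tab (next_forests tab)
  else [:: [:: [::]]].

(* The forests with n vertices; finitely many since C is finite.               *)
Definition forests (n : nat) : seq (forest C) := nth [::] (forest_table n) n.

Definition forests_upto (n : nat) : seq (forest C) :=
  flatten [seq forests k | k <- iota 0 n.+1].

Definition forest_pairs (n : nat) : seq (forest C * forest C) :=
  flatten [seq [seq (a, b) | a <- forests k, b <- forests (n - k)]
          | k <- iota 0 n.+1].
End Enumeration.

Section EnumerationTheory.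
Variable C : finType.
Local Open Scope nat_scope.

Lemma size_forest_table n : size (forest_table C n) = n.+1.
Proof. by elim: n => //= n IH; rewrite size_rcons IH. Qed.

Lemma nth_forest_table n k : k <= n ->
  nth [::] (forest_table C n) k = forests C k.
Proof.
elim: n => [|n IH]; first by rewrite leqn0 => /eqP->.
rewrite leq_eqVlt => /predU1P[-> //|]; rewrite ltnS => le_kn /=.
by rewrite nth_rcons size_forest_table ltnS le_kn IH.
Qed.

Lemma forestsS n : forests C n.+1 =
  [seq Node c sf.1 :: sf.2 | c <- enum C, sf <- forest_pairs C n].
Proof.
rewrite /forests -[forest_table C n.+1]/(rcons _ (next_forests _)).
rewrite nth_rcons size_forest_table ltnn eqxx /next_forests size_forest_table.
congr allpairs; rewrite /forest_pairs [n.+1.-1]/=.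
congr flatten; apply/eq_in_map => k; rewrite mem_iota add0n ltnS => le_kn.
by rewrite !nth_forest_table ?leq_subr.
Qed.

Lemma mem_forest_pairs_of n :
  (forall k, k <= n -> forall w, (w \in forests C k) = (fdeg w == k)) ->
  forall p, (p \in forest_pairs C n) = (fdeg p.1 + fdeg p.2 == n).
Proof.
move=> mem [a b]; apply/flatten_mapP/eqP.
  case=> k; rewrite mem_iota add0n ltnS => le_kn.
  case/allpairsP=> -[x y] /= [xk yk [-> ->]].
  rewrite mem // in xk; rewrite mem ?leq_subr // in yk.
  by rewrite (eqP xk) (eqP yk) subnKC.
move=> ab_n; rewrite /= in ab_n; have le_an : fdeg a <= n by rewrite -ab_n leq_addr.
exists (fdeg a); first by rewrite mem_iota add0n ltnS.
apply/allpairsP; exists (a, b); split=> //=.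
  by rewrite mem.
by rewrite mem ?leq_subr // -ab_n addKn.
Qed.

Lemma mem_forests n w : (w \in forests C n) = (fdeg w == n).
Proof.
elim/ltn_ind: n w => -[_ [|[c s] w] //|n IH w].
rewrite forestsS; have IHn k : k <= n -> _ := IH k.
apply/allpairsP/eqP => [[[c p] /= [_ p_n ->]] | ].
  rewrite mem_forest_pairs_of // in p_n.
  by rewrite /fdeg /= addSn; congr S; exact/eqP.
case: w => [|[c s] f] //; rewrite /fdeg /= addSn => -[sf_n].
exists (c, (s, f)); split=> //=; first by rewrite mem_enum.
by rewrite mem_forest_pairs_of //; apply/eqP.
Qed.

Lemma mem_forest_pairs n p :
  (p \in forest_pairs C n) = (fdeg p.1 + fdeg p.2 == n).
Proof. by apply: mem_forest_pairs_of => k _ w; exact: mem_forests. Qed.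

Lemma mem_forests_upto n w : (w \in forests_upto C n) = (fdeg w <= n).
Proof.
apply/flatten_mapP/idP => [[k]|le_n].
  by rewrite mem_iota mem_forests add0n ltnS => le_kn /eqP->.
by exists (fdeg w); rewrite ?mem_forests // mem_iota add0n ltnS.
Qed.

Lemma flatten_uniq (T U : eqType) (d : T -> U) (g : U -> seq T) (s : seq U) :
  uniq s -> (forall k, uniq (g k)) -> (forall k x, x \in g k -> d x = k) ->
  uniq (flatten [seq g k | k <- s]).
Proof.
move=> + ug dg; elim: s => //= k s IH /andP[ks us].
rewrite cat_uniq ug IH // andbT; apply/hasPn => x /flatten_mapP[l ls xl].
by apply: contra ks => /dg <-; rewrite (dg _ _ xl).
Qed.

Lemma uniq_forest_pairs_of n : (forall k, k <= n -> uniq (forests C k)) ->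
  uniq (forest_pairs C n).
Proof.
move=> un; rewrite /forest_pairs.
have -> : [seq [seq (a, b) | a <- forests C k, b <- forests C (n - k)]
          | k <- iota 0 n.+1]
        = [seq (if k <= n then [seq (a, b) | a <- forests C k, b <- forests C (n - k)] else [::])
          | k <- iota 0 n.+1].
  by apply/eq_in_map => k; rewrite mem_iota add0n ltnS /= => ->.
apply: (flatten_uniq (d := fun p => fdeg p.1)); first exact: iota_uniq.
  move=> k; case: ifP => // le_kn.
  by apply: allpairs_uniq; rewrite ?un ?leq_subr // => -[? ?] [? ?].
move=> k x; case: ifP => // _ /allpairsP[-[a b] /= [ak _ ->]] /=.
by apply/eqP; rewrite -mem_forests.
Qed.

Lemma uniq_forests n : uniq (forests C n).
Proof.
elim/ltn_ind: n => -[//|n IH]; rewrite forestsS.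
apply: allpairs_uniq; first exact: enum_uniq.
  exact: uniq_forest_pairs_of.
by move=> [c [s f]] [c' [s' f']] _ _ /= [-> -> ->].
Qed.

Lemma uniq_forest_pairs n : uniq (forest_pairs C n).
Proof. by apply: uniq_forest_pairs_of => k _; exact: uniq_forests. Qed.

Lemma uniq_forests_upto n : uniq (forests_upto C n).
Proof.
apply: (flatten_uniq (d := @fdeg C)); first exact: iota_uniq.
  by move=> k; exact: uniq_forests.
by move=> k w; rewrite mem_forests => /eqP.
Qed.
End EnumerationTheory.

Lemma mem_unshuffle_fdeg (C : choiceType) (w : forest C) p :
  p \in unshuffle w -> (fdeg p.1 + fdeg p.2 = fdeg w)%N.
Proof.
elim: w p => [|t w IH] p /=; first by rewrite inE => /eqP->.
by rewrite mem_cat => /orP[] /mapP[q /IH + ->]; rewrite /fdeg /=; lia.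
Qed.

Lemma mem_graft_fdeg (C : choiceType) (a b w : forest C) :
  w \in graft a b -> fdeg w = (fdeg a + fdeg b)%N.
Proof.
have graft_branchesE c (s : forest C) v : graft_tree (Node c s) v =
    [seq Node c (p.1 ++ f) | p <- unshuffle v, f <- graft p.2 s].
  rewrite /=; congr flatten; apply: eq_map => p; congr map.
  by elim: s p.2 => //= t s IH u; congr flatten; apply: eq_map => q; rewrite IH.
have graft_deg (s : forest C) :
    (forall t, t \in s -> forall v u, u \in graft_tree t v -> tdeg u = (fdeg v + tdeg t)%N) ->
    forall v u, u \in graft v s -> fdeg u = (fdeg v + fdeg s)%N.
  elim: s => [|t s IH] Hs v u /=; first by case: v => // ; rewrite inE => /eqP->.
  case/flatten_mapP=> p /mem_unshuffle_fdeg dp /allpairsP[[t' s'] /= [t't s's ->]].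
  have := Hs t (mem_head _ _) _ _ t't.
  have := IH (fun t1 t1s => Hs t1 (@mem_behead _ (t :: s) _ t1s)) _ _ s's.
  by move: dp; rewrite /fdeg /= => <- -> ->; rewrite addnACA addnC.
apply: (graft_deg) => t _; move: t; fix IH 1; case=> c s v u; rewrite graft_branchesE.
case/flatten_mapP=> p /mem_unshuffle_fdeg dp /mapP[f fs ->].
have {fs} : fdeg f = (fdeg p.2 + fdeg s)%N.
  move: p.2 f fs; apply: (graft_deg); elim: s => // t s IHs t'.
  by rewrite inE => /predU1P[->|]; [exact: IH | exact: IHs].
by move=> /= e; rewrite map_cat sumn_cat -!/(fdeg _) e addnA dp addnS.
Qed.

Section Pairing.
Variables (K : fieldType) (I : choiceType).

Definition linext (V : lmodType K) (h : I -> V) (x : {malg K[I]}) : V :=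
  \sum_(k <- msupp x) x@_k *: h k.

(* The pairing for which the basis I is orthonormal, between formal series     *)
(* (arbitrary functions on I) and finite linear combinations.                  *)
Definition pairing (A : I -> K) (x : {malg K[I]}) : K :=
  \sum_(k <- msupp x) A k * x@_k.

Lemma big_uniq_sub (V : nmodType) (T : eqType) (s t : seq T) (F : T -> V) :
  uniq s -> uniq t -> {subset t <= s} ->
  {in s, forall x, x \notin t -> F x = 0} ->
  \sum_(x <- s) F x = \sum_(x <- t) F x.
Proof.
move=> us ut ts F0; rewrite (bigID (mem t)) /= [X in _ + X]big1_seq ?addr0.
  rewrite -big_filter; apply: perm_big; apply: uniq_perm => //.
    exact: filter_uniq.
  by move=> x; rewrite mem_filter; apply: andb_idr => /ts.
by move=> x /andP[xt xs]; exact: F0.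
Qed.

Lemma linextEw (V : lmodType K) (h : I -> V) (x : {malg K[I]}) (s : seq I) :
  uniq s -> {subset msupp x <= s} -> linext h x = \sum_(k <- s) x@_k *: h k.
Proof.
move=> us xs; apply/esym/(big_uniq_sub us (fset_uniq _)) => //.
by move=> k _ /mcoeff_outdom ->; rewrite scale0r.
Qed.

Lemma linext_is_linear (V : lmodType K) (h : I -> V) : linear (linext h).
Proof.
move=> a x y; have us := fset_uniq (msupp x `|` msupp y)%fset.
have sx : {subset msupp x <= (msupp x `|` msupp y)%fset}.
  by move=> k kx; rewrite in_fsetU kx.
have sy : {subset msupp y <= (msupp x `|` msupp y)%fset}.
  by move=> k ky; rewrite in_fsetU ky orbT.
have sxy : {subset msupp (a *: x + y) <= (msupp x `|` msupp y)%fset}.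
  move=> k; rewrite in_fsetU -!mcoeff_neq0 mcoeffD mcoeffZ.
  apply: contraR; rewrite negb_or !negbK => /andP[/eqP-> /eqP->].
  by rewrite mulr0 addr0.
rewrite (linextEw h us sx) (linextEw h us sy) (linextEw h us sxy).
rewrite scaler_sumr -big_split; apply: eq_bigr => k _ /=.
by rewrite mcoeffD mcoeffZ scalerDl scalerA.
Qed.

HB.instance Definition _ (V : lmodType K) (h : I -> V) :=
  GRing.isLinear.Build K {malg K[I]} V *:%R (linext h) (linext_is_linear h).

Lemma linextU (V : lmodType K) (h : I -> V) (c : K) (k : I) :
  linext h << c *g k >> = c *: h k.
Proof.
rewrite (@linextEw _ h _ [:: k]) ?big_seq1 ?mcoeffUU // => l.
rewrite inE -mcoeff_neq0 mcoeffU (eq_sym l); case: (k == l) => //.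
by rewrite mulr0n eqxx.
Qed.

Lemma linext_sum (V : lmodType K) (h : I -> V) (J : Type) (r : seq J)
    (F : J -> {malg K[I]}) :
  linext h (\sum_(j <- r) F j) = \sum_(j <- r) linext h (F j).
Proof. exact: linear_sum. Qed.

Lemma pairingEw (A : I -> K) (x : {malg K[I]}) (s : seq I) :
  uniq s -> {subset msupp x <= s} -> pairing A x = \sum_(k <- s) A k * x@_k.
Proof.
move=> us xs; apply/esym/(big_uniq_sub us (fset_uniq _)) => //.
by move=> k _ /mcoeff_outdom ->; rewrite mulr0.
Qed.

Lemma pairing_linext (A : I -> K) x :
  pairing A x = linext (A : I -> K^o) x.
Proof. by apply: eq_bigr => k _; rewrite mulrC. Qed.
End Pairing.

Section Forests.
Variables (K : fieldType) (C : finType).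

Definition OF := {malg K[forest C]}.

(* OF (x) OF, with basis the pairs of forests.                                 *)
Definition OF2 := {malg K[(forest C * forest C)%type]}.

Definition coproduct : OF -> OF2 :=
  linext (fun w => \sum_(p <- unshuffle w) (<< p >> : OF2)).

Definition grafting (A B : OF) : OF :=
  linext (fun a => linext (fun b => \sum_(w <- graft a b) (<< w >> : OF)) B) A.

Definition bracket (A B : OF) : OF := A * B - B * A.

(* A * B = A_(1) . (A_(2) |> B)                                                *)
Definition grossman_larson (A B : OF) : OF :=
  linext (fun p => (<< p.1 >> : OF) * grafting << p.2 >> B) (coproduct A).

Inductive is_lie : OF -> Prop :=
  | lie_tree (t : tree C) : is_lie << [:: t] : forest C >>
  | lie_zero : is_lie 0
  | lie_add x y : is_lie x -> is_lie y -> is_lie (x + y)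
  | lie_scale (a : K) x : is_lie x -> is_lie (a *: x)
  | lie_bracket x y : is_lie x -> is_lie y -> is_lie (bracket x y).

Record lie := Lie { lie_val :> OF; lie_valP : is_lie lie_val }.

(* The completion of OF: since C is finite each homogeneous component is       *)
(* finite-dimensional, and the product of these components consists of all     *)
(* the families of coefficients.                                               *)
Definition OFbar := forest C -> K.

Definition trunc (n : nat) (A : OFbar) : OF :=
  \sum_(w <- forests_upto C n) << A w *g w >>.

(* Continuous extension of a bilinear operation of degree 0.                   *)
Definition ext2 (op : OF -> OF -> OF) (A B : OFbar) : OFbar :=
  fun x => (op (trunc (fdeg x) A) (trunc (fdeg x) B))@_x.

Definition bracket_bar : OFbar -> OFbar -> OFbar := ext2 bracket.
Definition grafting_bar : OFbar -> OFbar -> OFbar := ext2 grafting.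
Definition grossman_larson_bar : OFbar -> OFbar -> OFbar := ext2 grossman_larson.

Definition coproduct_bar (A : OFbar) : forest C * forest C -> K :=
  fun p => (coproduct (trunc (fdeg p.1 + fdeg p.2) A))@_p.

Definition one_bar : OFbar := fun w => (w == [::])%:R.
Definition bullet_bar (i : C) : OFbar := fun w => (w == [:: leaf i])%:R.

Definition tens (A B : OFbar) : forest C * forest C -> K :=
  fun p => A p.1 * B p.2.

(* Also membership in the completion of Lie(PT), by Friedrichs' criterion in   *)
(* characteristic 0.                                                           *)
Definition primitive (A : OFbar) : Prop :=
  forall p, coproduct_bar A p = tens A one_bar p + tens one_bar A p.

Definition group_like (A : OFbar) : Prop :=
  A [::] = 1 /\ coproduct_bar A =1 tens A A.

(* The coaction dual to grafting: the coefficient of a (x) b in its value at a *)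
(* forest w is the coefficient of w in a |> b.                                 *)
Definition rho_graft : OF -> OF2 :=
  linext (fun w => \sum_(p <- forest_pairs C (fdeg w))
    (<< (grafting << p.1 >> << p.2 >>)@_w *g p >> : OF2)).

Lemma graftingE (a b : forest C) :
  grafting (<< a >> : OF) << b >> = \sum_(w <- graft a b) << w >>.
Proof. by rewrite /grafting !linextU !scale1r. Qed.

Lemma grafting_trunc n (A B : OFbar) : grafting (trunc n A) (trunc n B) =
  \sum_(a <- forests_upto C n) \sum_(b <- forests_upto C n)
     (A a * B b) *: grafting (<< a >> : OF) << b >>.
Proof.
rewrite {1}/grafting {1}/trunc linext_sum; apply: eq_bigr => a _ /=.
rewrite linextU linext_sum scaler_sumr; apply: eq_bigr => b _ /=.
by rewrite linextU graftingE scalerA.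
Qed.

Lemma rho_graftP (A B : OFbar) (x : OF) :
  pairing (grafting_bar A B) x = pairing (tens A B) (rho_graft x).
Proof.
rewrite [RHS]pairing_linext /rho_graft {2}/linext linext_sum.
apply: eq_bigr => w _; rewrite linearZ /= mulrC; congr (_ * _).
rewrite linext_sum /grafting_bar /ext2 grafting_trunc.
pose F (p : forest C * forest C) :=
  tens A B p * (grafting (<< p.1 >> : OF) << p.2 >>)@_w.
have -> : \sum_(p <- forest_pairs C (fdeg w)) linext (tens A B : _ -> K^o)
    << (grafting (<< p.1 >> : OF) << p.2 >>)@_w *g p >> =
    \sum_(p <- forest_pairs C (fdeg w)) F p.
  by apply: eq_bigr => p _; rewrite linextU /F mulrC.
have upto2 : uniq [seq (a, b) | a <- forests_upto C (fdeg w), b <- forests_upto C (fdeg w)].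
  by apply: allpairs_uniq; rewrite ?uniq_forests_upto // => -[? ?] [].
rewrite -(big_uniq_sub upto2 (uniq_forest_pairs C (fdeg w))).
- rewrite big_allpairs linear_sum; apply: eq_bigr => a _.
  by rewrite linear_sum; apply: eq_bigr => b _; rewrite /= mcoeffZ.
- move=> [a b]; rewrite mem_forest_pairs => /eqP ab_w.
  by apply/allpairsP; exists (a, b); rewrite !mem_forests_upto -ab_w leq_addl leq_addr.
move=> p _; rewrite mem_forest_pairs /F => Np.
rewrite graftingE linear_sum big1_seq ?mulr0 // => u /= /mem_graft_fdeg eu.
rewrite mcoeffU1; case: eqP => // uw; case/eqP: Np; by rewrite -eu uw.
Qed.

(* For the topology given by the grading.                                      *)
Definition continuous_bar (T : OFbar -> OFbar) : Prop :=
  forall n, exists m, forall A : OFbar,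
    (forall w, (fdeg w <= m)%N -> A w = 0) ->
    forall w, (fdeg w <= n)%N -> T A w = 0.

Record is_translation (v : C -> OFbar) (T : OFbar -> OFbar) : Prop := {
  translation_linear : forall (a : K) (A B : OFbar),
    T (fun w => a * A w + B w) =1 (fun w => a * T A w + T B w);
  translation_continuous : continuous_bar T;
  translation_bullet : forall i,
    T (bullet_bar i) =1 (fun w => bullet_bar i w + v i w);
  translation_primitive : forall A, primitive A -> primitive (T A);
  translation_bracket : forall A B, primitive A -> primitive B ->
    T (bracket_bar A B) =1 bracket_bar (T A) (T B);
  translation_grafting : forall A B, primitive A -> primitive B ->
    T (grafting_bar A B) =1 grafting_bar (T A) (T B);
  translation_one : T one_bar =1 one_bar;
  translation_grossman_larson : forall A B,
    T (grossman_larson_bar A B) =1 grossman_larson_bar (T A) (T B)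
}.

(* S(Lie(PT) x C) is spanned by the monomials (l_1, i_1) ... (l_k, i_k). It is *)
(* paired with its completion by <FG, m> = <F (x) G, Delta m>, the generators  *)
(* being primitive and paired by <(u, i), (l, j)> = [i = j] <u, l>. A series   *)
(* is represented by its pairings with the monomials, so that the product of   *)
(* series is the convolution for the (unshuffle) coproduct of monomials.       *)
Definition smonom := seq (lie * C).

Definition sym_bar := smonom -> K.

Definition sym_one : sym_bar := fun m => (nilp m)%:R.

Definition sym_mul (f g : sym_bar) : sym_bar :=
  fun m => \sum_(p <- unshuffle m) f p.1 * g p.2.

(* The generator (u, i).                                                       *)
Definition sym_gen (u : OFbar) (i : C) : sym_bar := fun m =>
  if m is [:: (l, j)] then (if j == i then pairing u (lie_val l) else 0) else 0.

(* For f vanishing on the empty monomial, f ^ k vanishes on the monomials of   *)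
(* length less than k.                                                         *)
Definition sym_exp (f : sym_bar) : sym_bar :=
  fun m => \sum_(k < (size m).+1) (k`!%:R)^-1 * iter k (sym_mul f) sym_one m.

Definition exp_char (v : C -> OFbar) : sym_bar :=
  sym_exp (fun m => \sum_(i : C) sym_gen (v i) i m).

(* Representatives of the elements of S(Lie(PT) x C) (x) OF: formal sums of    *)
(* c (l_1, i_1) ... (l_k, i_k) (x) w.                                          *)
Definition symOF := seq (K * (smonom * forest C)).

Definition pairing_symOF (f : sym_bar) (A : OFbar) (z : symOF) : K :=
  \sum_(p <- z) p.1 * (f p.2.1 * A p.2.2).

(* Polynomial functions separate the elements of a symmetric algebra over an   *)
(* infinite field, so this determines rhoT x as an element of S (x) OF, which  *)
(* in particular depends linearly on x.                                        *)
Definition dual_coaction (T : (C -> OFbar) -> OFbar -> OFbar)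
    (rhoT : OF -> symOF) : Prop :=
  forall v, (forall i, primitive (v i)) -> forall (A : OFbar) (x : OF),
    pairing (T v A) x = pairing_symOF (exp_char v) A (rhoT x).

End Forests.

(* Main.v *)
(* For a tree t the series exp (a t) is group-like, and both T_v and xi |> _    *)
(* are linear and continuous, so comparing the terms linear in a gives          *)
(* T_v t = xi |> t for every tree t.  Apply this to the bullet o = leaf j and   *)
(* to the ladder o |> o: as T_v is a morphism for |>,                           *)
(*   xi |> (o |> o) = (xi |> o) |> (xi |> o).                                   *)
(* Since xi is group-like, writing B for the grafting of a forest on the root j *)
(* this reads B (xi . B xi) = B xi |> B xi, that is,                            *)
(*   xi . B xi = B xi . xi + B xi |> xi.                                        *)
(* In the lowest positive degree n of xi this says that the component xi_n      *)
(* satisfies xi_n . leaf j = leaf j . xi_n + leaf j |> xi_n.  Grafting keeps    *)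
(* the number of trees, so the longest part of xi_n commutes with the letter    *)
(* leaf j and is a multiple of (leaf j)^n; it vanishes by primitivity if n > 1, *)
(* and by the coefficient of the ladder if n = 1.  Hence xi = 1, and v_i = 0    *)
(* follows from leaf i + v_i = xi |> leaf i = leaf i.                           *)

Require Import Defs.
From mathcomp Require Import all_boot all_order all_algebra finmap zify ring.
Set Implicit Arguments.
Unset Strict Implicit.
Unset Printing Implicit Defensive.
Import GRing.Theory.
Local Open Scope ring_scope.

(** Exponentials of trees are group-like and their linear terms are the trees, so the identity on
    group-like series descends to T_v t = xi |> t for every tree t ([exp_tree_group_like],
    [exp_tree_linear_part]). Translation respects |>, whereas xi |> _ splits the roots of xi among
    the vertices of its argument. Comparing both on the ladder with two vertices gives a quadratic
    relation on xi, whose two sides are computed by [grafting_bar_ladder] and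
    [grafting_bar_bullets]. In the lowest positive degree this relation is linear and, up to longer
    forests, says that xi commutes with the letter leaf j. [group_like_eq_one] concludes xi = 1 from
    it, and evaluating T_v on the bullets then gives v = 0. *)

(** * Unshuffling and grafting of forests *)

Section Combinatorics.
Variable C : choiceType.
Implicit Types (a b w f : forest C) (t : tree C).

Lemma fdeg_cons t w : fdeg (t :: w) = (tdeg t + fdeg w)%N.
Proof. by []. Qed.

Lemma fdeg_seq1 t : fdeg [:: t] = tdeg t.
Proof. exact: addn0. Qed.

Lemma fdeg_cat a b : fdeg (a ++ b) = (fdeg a + fdeg b)%N.
Proof. by rewrite /fdeg map_cat sumn_cat. Qed.

Lemma fdeg_rcons w t : fdeg (rcons w t) = (fdeg w + tdeg t)%N.
Proof. by rewrite -cats1 fdeg_cat fdeg_cons addn0. Qed.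

Lemma tdeg_Node (c : C) w : tdeg (Node c w) = (fdeg w).+1.
Proof. by []. Qed.

Lemma size_le_fdeg w : (size w <= fdeg w)%N.
Proof. by elim: w => // -[c s] w IH; rewrite fdeg_cons tdeg_Node /=; lia. Qed.

Lemma fdeg_eq0 w : (fdeg w == 0%N) = (w == [::]).
Proof. by case: w => // -[c s] w. Qed.

Lemma perm_unshuffle (T : eqType) (w : seq T) p :
  p \in unshuffle w -> perm_eq (p.1 ++ p.2) w.
Proof.
elim: w p => [|t w IH] p /=; first by rewrite inE => /eqP->.
rewrite mem_cat => /orP[] /mapP[q /IH q_w ->] /=; first by rewrite perm_cons.
by rewrite -cat1s perm_catCA /= perm_cons.
Qed.

(** Pascal's rule, according to the side that receives the first letter. *)
Lemma count_unshuffle_nseq (T : eqType) (t : T) m k :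
  count_mem (nseq m t, nseq k t) (unshuffle (nseq (m + k) t)) = 'C(m + k, m).
Proof.
have countl (a b : seq T) s :
    count_mem (t :: a, b) [seq (t :: p.1, p.2) | p <- s] = count_mem (a, b) s.
  rewrite count_map; apply: eq_count => -[x y] /=.
  by rewrite !xpair_eqE eqseq_cons eqxx.
have countr (a b : seq T) s :
    count_mem (a, t :: b) [seq (p.1, t :: p.2) | p <- s] = count_mem (a, b) s.
  rewrite count_map; apply: eq_count => -[x y] /=.
  by rewrite !xpair_eqE eqseq_cons eqxx.
have [n] := ubnP (m + k); elim: n m k => // n IH [|m] [|k] lt_n //.
- rewrite bin0 [X in unshuffle X]/= count_cat countr.
  rewrite count_map (@eq_count _ _ pred0) ?count_pred0; last by case.
  by rewrite (IH 0) ?bin0.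
- rewrite addn0 binn [X in unshuffle X]/= count_cat countl.
  rewrite [X in (_ + X)%N]count_map [X in (_ + X)%N](@eq_count _ _ pred0) ?count_pred0.
    by have := IH m 0; rewrite !addn0 binn; apply; move: lt_n; lia.
  by move=> [x y] /=; rewrite xpair_eqE andbF.
rewrite addSn [X in unshuffle X]/= count_cat countl countr binS -{2}addSnnS !IH //; try lia.
by rewrite addSnnS addnC.
Qed.

(** Identifies the anonymous inner fixpoint of [graft_tree] with [graft]. *)
Lemma graft_Node (c : C) s w : graft_tree (Node c s) w =
  [seq Node c (p.1 ++ f) | p <- unshuffle w, f <- graft p.2 s].
Proof.
rewrite /=; congr flatten; apply: eq_map => p; congr map.
by elim: s p.2 => //= t s IH u; congr flatten; apply: eq_map => q; rewrite IH.
Qed.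

Lemma graft_cons w t f : graft w (t :: f) =
  flatten [seq [seq u :: g | u <- graft_tree t p.1, g <- graft p.2 f]
          | p <- unshuffle w].
Proof. by []. Qed.

(** The roots of [b] remain the roots of the result; the induction on the number of trees in
    [group_like_eq_one] rests on this. *)
Lemma size_graft a b w : w \in graft a b -> size w = size b.
Proof.
elim: b a w => [|t b IH] [|s a] w //=; rewrite ?inE; first by move/eqP->.
  by rewrite cats0 => /allpairsP[[u g] /= [_ /IH e ->]]; rewrite /= e.
by case/flatten_mapP=> p _ /allpairsP[[u g] /= [_ /IH e ->]]; rewrite /= e.
Qed.

(** Exactly one splitting of [w] has an empty second part, namely [(w, [::])]. This handles grafting
    onto an empty forest, where no root may be left over. *)
Lemma flatten_unshuffle_pred (T U : Type) (w : seq T) (F : seq T -> seq U) :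
  flatten [seq (if p.2 is [::] then F p.1 else [::]) | p <- unshuffle w] = F w.
Proof.
elim: w F => [|t w IH] F /=; first by rewrite cats0.
rewrite map_cat flatten_cat -!map_comp (IH (F \o cons t)).
have -> : flatten [seq (fun p => if p.2 is [::] then F p.1 else [::]) ((fun q => (q.1, t :: q.2)) p) | p <- unshuffle w] = [::].
  by elim: (unshuffle w).
by rewrite cats0.
Qed.

Lemma graft_seq1 w t : graft w [:: t] = [seq [:: u] | u <- graft_tree t w].
Proof.
rewrite graft_cons -[RHS](flatten_unshuffle_pred w (fun w => [seq [:: u] | u <- graft_tree t w])).
congr flatten; apply: eq_map => -[a [|s b]] /=; first by elim: (graft_tree t a) => //= u l ->.
by elim: (graft_tree t a).
Qed.

Lemma graft_nil_r w : graft w [::] = if w is [::] then [:: [::]] else [::].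
Proof. by case: w. Qed.

Lemma graft_leaf w (c : C) : graft w [:: leaf c] = [:: [:: Node c w]].
Proof.
rewrite graft_seq1 graft_Node.
rewrite -[[:: [:: Node c w]]]/([seq [:: u] | u <- [:: Node c w]]); congr map.
rewrite -[RHS](flatten_unshuffle_pred w (fun w => [:: Node c w])).
by congr flatten; apply: eq_map => -[a [|s b]] //=; rewrite cats0.
Qed.

(** Each root of [w] goes to the root or to the leaf of the ladder; the old branch comes last since
    grafting is leftmost. *)
Lemma graft_ladder w (c d : C) : graft w [:: Node c [:: leaf d]] =
  [seq [:: Node c (rcons p.1 (Node d p.2))] | p <- unshuffle w].
Proof.
rewrite graft_seq1 graft_Node.
transitivity [seq [:: u] |
  u <- [seq Node c (rcons p.1 (Node d p.2)) | p <- unshuffle w]]; last first.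
  by rewrite -map_comp.
congr map; rewrite -[RHS]flatten_map1; congr flatten; apply: eq_map => p.
by rewrite graft_leaf /= cats1.
Qed.

Lemma graft_nil w : graft [::] w = [:: w].
Proof.
have graftE s : (forall t, t \in s -> graft_tree t [::] = [:: t]) ->
    graft [::] s = [:: s].
  elim: s => // t s IH Hs; rewrite graft_cons /= Hs ?mem_head //=.
  by rewrite IH // => u us; rewrite Hs // in_cons us orbT.
apply: (graftE) => t _; move: t; fix IH 1; case=> c s.
suff Hs : forall t, t \in s -> graft_tree t [::] = [:: t].
  by rewrite graft_Node /= (graftE s Hs).
elim: s => [|t s IHs] u; first by rewrite in_nil; discriminate.
by rewrite inE => /predU1P[->|]; [exact: IH | exact: IHs].
Qed.

Lemma graft_tree1 t (c : C) w : graft [:: t] [:: Node c w] =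
  [:: Node c (t :: w)] :: [seq [:: Node c f] | f <- graft [:: t] w].
Proof.
by rewrite graft_seq1 graft_Node /= graft_nil cats0 /= -map_comp.
Qed.

Lemma eq_Node (c d : C) (a b : forest C) :
  (Node c a == Node d b) = (c == d) && (a == b).
Proof. by apply/eqP/andP => [[-> ->] | [/eqP-> /eqP->]]. Qed.
End Combinatorics.

(** * Grafting and coproduct of series, by coefficients *)

Section Series.
Variables (K : fieldType) (C : finType).
Implicit Types (A B : OFbar K C) (x w : forest C) (p : forest C * forest C).

(** Extends [bullet_bar i], which is convertible to [delta_bar [:: leaf i]], to all forests. *)
Definition delta_bar w : OFbar K C := fun x => (x == w)%:R.

Lemma mcoeff_sumU (I : choiceType) (s : seq I) (i : I) :
  (\sum_(k <- s) (<< k >> : {malg K[I]}))@_i = (count_mem i s)%:R.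
Proof.
elim: s => [|k s IH]; first by rewrite big_nil mcoeff0.
by rewrite big_cons mcoeffD IH mcoeffU natrD.
Qed.

Lemma pairingU A x : pairing A << x >> = A x.
Proof. by rewrite pairing_linext linextU scale1r. Qed.

Lemma grafting_barE A B x : grafting_bar A B x =
  \sum_(p <- forest_pairs C (fdeg x))
    A p.1 * B p.2 * (count_mem x (graft p.1 p.2))%:R.
Proof.
rewrite -pairingU rho_graftP pairing_linext /rho_graft linextU scale1r.
rewrite linext_sum; apply: eq_bigr => p _.
rewrite linextU graftingE mcoeff_sumU; exact: mulrC.
Qed.

Lemma coproduct_barE A p : coproduct_bar A p =
  \sum_(w <- forests C (fdeg p.1 + fdeg p.2))
    A w * (count_mem p (unshuffle w))%:R.
Proof.
rewrite /coproduct_bar /coproduct /trunc linext_sum raddf_sum /=.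
rewrite (eq_bigr (fun w => A w * (count_mem p (unshuffle w))%:R)); last first.
  by move=> w _; rewrite linextU mcoeffZ mcoeff_sumU.
apply: big_uniq_sub (uniq_forests_upto _ _) (uniq_forests _ _) _ _ => w.
  by rewrite mem_forests mem_forests_upto => /eqP->.
move=> _; rewrite mem_forests => w_p.
rewrite (count_memPn _) ?mulr0 //; apply: contra w_p => /mem_unshuffle_fdeg ->.
exact: eqxx.
Qed.

Lemma sum_delta_bar n b (F : forest C -> K) : (fdeg b <= n)%N ->
  \sum_(p <- forest_pairs C n) delta_bar b p.2 * F p.1 =
  \sum_(w <- forests C (n - fdeg b)) F w.
Proof.
move=> b_n; rewrite (big_uniq_sub (t := [seq (w, b) | w <- forests C (n - fdeg b)])).
- rewrite big_map; apply: eq_bigr => w _.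
  by rewrite /delta_bar eqxx mul1r.
- exact: uniq_forest_pairs.
- by rewrite map_inj_uniq ?uniq_forests // => ? ? [].
- by move=> _ /mapP[w + ->]; rewrite mem_forests mem_forest_pairs => /eqP-> /=; rewrite subnK.
move=> [a b']; rewrite mem_forest_pairs /delta_bar /= => /eqP ab.
case: eqP => [eb|_ _]; last by rewrite mul0r.
by rewrite -ab eb addnK map_f // mem_forests.
Qed.

Lemma eq_grafting_bar A A' B B' :
  A =1 A' -> B =1 B' -> grafting_bar A B =1 grafting_bar A' B'.
Proof.
move=> eA eB x; rewrite !grafting_barE; apply: eq_bigr => p _.
by rewrite eA eB.
Qed.

Lemma grafting_bar_linear A (a : K) B B' x :
  grafting_bar A (fun w => a * B w + B' w) x =
  a * grafting_bar A B x + grafting_bar A B' x.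
Proof.
rewrite !grafting_barE mulr_sumr -big_split; apply: eq_bigr => p _ /=; ring.
Qed.

Lemma grafting_bar_continuous A : continuous_bar (grafting_bar A).
Proof.
move=> n; exists n => B B0 w w_n; rewrite grafting_barE big1_seq // => p /=.
rewrite mem_forest_pairs => /eqP e; rewrite B0 ?mulr0 ?mul0r //.
by rewrite (leq_trans _ w_n) // -e leq_addl.
Qed.

(** Grafting onto a single vertex joins the trees of a forest under a new root: this is the operator
    B in degree-by-degree form. *)
Lemma grafting_bar_bullet A (c : C) x :
  grafting_bar A (delta_bar [:: leaf c]) x =
  if x is [:: Node d w] then (d == c)%:R * A w else 0.
Proof.
have [->|x_gt0] := eqVneq x [::].
  rewrite grafting_barE big1_seq // => p /= _.
  by rewrite /delta_bar; case: eqP => [->|]; rewrite ?graft_leaf /= ?mulr0 ?mul0r.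
rewrite grafting_barE (eq_bigr (fun p => delta_bar [:: leaf c] p.2 *
   (A p.1 * ([:: Node c p.1] == x)%:R))); last first.
  move=> p _; rewrite mulrCA mulrA /delta_bar.
  by case: eqP => [->|]; rewrite ?mulr0 ?mul0r // graft_leaf /= addn0.
have x1 : (fdeg [:: leaf c] <= fdeg x)%N by rewrite lt0n fdeg_eq0.
rewrite (sum_delta_bar (fun w => A w * ([:: Node c w] == x)%:R)) //.
case: x x_gt0 x1 => // -[d w] [|t x] _ _; last first.
  by rewrite big1 // => w' _; rewrite eqseq_cons andbF mulr0.
rewrite (big_uniq_sub (t := [:: w])) ?uniq_forests //.
- by rewrite big_seq1 eqseq_cons eq_Node !eqxx !andbT eq_sym mulrC.
- move=> w'; rewrite inE => /eqP->; rewrite mem_forests fdeg_cons tdeg_Node /=.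
  by rewrite /fdeg /=; lia.
by move=> w' _; rewrite inE eqseq_cons eq_Node => /negPf->; rewrite andbF mulr0.
Qed.

Lemma primitive_delta_bar (t : tree C) : primitive (delta_bar [:: t]).
Proof.
move=> [a b]; rewrite coproduct_barE /tens /one_bar /delta_bar /=.
have [e|ne] := eqVneq (fdeg a + fdeg b)%N (fdeg [:: t]).
  rewrite (big_uniq_sub (t := [:: [:: t]])) ?uniq_forests //.
  - rewrite big_seq1 eqxx mul1r /= addn0 natrD !xpair_eqE -!natrM !mulnb.
    by rewrite ![[:: t] == _]eq_sym ![[::] == _]eq_sym.
  - by move=> w; rewrite inE => /eqP->; rewrite mem_forests e.
  by move=> w _; rewrite inE => /negPf->; rewrite mul0r.
rewrite big1_seq => [|w /=]; last first.
  rewrite mem_forests => w_ab; case: eqP => [e|]; last by rewrite mul0r.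
  by rewrite -e eq_sym w_ab in ne.
have zero (u v : forest C) : (fdeg u + fdeg v != fdeg [:: t])%N ->
    (u == [:: t])%:R * (v == [::])%:R = 0 :> K.
  have [->|_ _] := eqVneq u; last by rewrite mul0r.
  by have [->|_ _] := eqVneq v; rewrite ?mulr0 // addn0 eqxx.
by rewrite zero // mulrC zero ?addr0 // addnC.
Qed.

(** * From group-like series to trees *)

(** The concatenation exponential of a t. *)
Definition exp_tree (t : tree C) (a : K) : OFbar K C := fun w =>
  if w == nseq (size w) t then a ^+ size w / (size w)`!%:R else 0.

(** Both sides vanish off pairs of powers of t. At (t^m, t^k) the coproduct counts C(m+k, m)
    unshuffles, and C(m+k, m) / (m+k)! = 1 / (m! k!). *)
Lemma exp_tree_group_like (K_char0 : [pchar K] =i pred0) t a :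
  group_like (exp_tree t a).
Proof.
have natr_eq0 n : (n%:R == 0 :> K) = (n == 0)%N.
  by move/pcharf0P: K_char0 => ->.
split=> [|[x y]]; first by rewrite /exp_tree /= expr0 fact0 divr1.
have nseqP n (u v : forest C) : (u, v) \in unshuffle (nseq n t) ->
    [/\ n = (size u + size v)%N, u = nseq (size u) t & v = nseq (size v) t].
  move/perm_unshuffle => /= uv; have := perm_size uv.
  rewrite size_cat size_nseq => e; split=> //; apply/all_pred1P.
    by have := perm_all (pred1 t) uv; rewrite all_nseq /= eqxx orbT all_cat => /andP[].
  by have := perm_all (pred1 t) uv; rewrite all_nseq /= eqxx orbT all_cat => /andP[].
rewrite coproduct_barE /tens /=.
have [/andP[/eqP ex /eqP ey]|nxy] :=
    boolP ((x == nseq (size x) t) && (y == nseq (size y) t)); last first.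
  rewrite big1 => [|w _].
    move: nxy; rewrite /exp_tree negb_and => /orP[] /negPf->; by rewrite ?mul0r ?mulr0.
  rewrite {1}/exp_tree; case: eqP => [->|]; last by rewrite mul0r.
  rewrite (count_memPn _) ?mulr0 //; apply: contra nxy => /nseqP[_ {1}-> {1}->].
  by rewrite !eqxx.
set m := size x in ex *; set k := size y in ey *.
have xy : x ++ y = nseq (m + k) t by rewrite nseqD -ex -ey.
rewrite (big_uniq_sub (t := [:: nseq (m + k) t])) ?uniq_forests //.
- rewrite big_seq1 ex ey count_unshuffle_nseq /exp_tree !size_nseq !eqxx exprD.
  have f0 n : n`!%:R != 0 :> K by rewrite natr_eq0 -lt0n fact_gt0.
  have := bin_fact (leq_addr k m); rewrite addKn => <-.
  have b0 : 'C(m + k, m)%:R != 0 :> K.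
    by rewrite natr_eq0 -lt0n bin_gt0 leq_addr.
  rewrite !natrM; field; by rewrite b0 !f0.
- by move=> w; rewrite inE => /eqP->; rewrite mem_forests -xy fdeg_cat.
move=> w _; rewrite inE /exp_tree => w_xy.
case: eqP => [ew|]; last by rewrite mul0r.
rewrite (count_memPn _) ?mulr0 //; apply: contra w_xy.
by rewrite ew => /nseqP[-> _ _].
Qed.

(* L (exp (a t)) is a polynomial in a with linear coefficient L t, and it has   *)
(* infinitely many zeros.                                                      *)
Lemma exp_tree_linear_part (K_char0 : [pchar K] =i pred0) (L : OFbar K C -> K) t :
  (forall (a : K) A B, L (fun w => a * A w + B w) = a * L A + L B) ->
  (exists m, forall A, (forall w, (fdeg w <= m)%N -> A w = 0) -> L A = 0) ->
  (forall a, L (exp_tree t a) = 0) -> L (delta_bar [:: t]) = 0.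
Proof.
move=> linL [m contL] L0.
have natr_eq0 n : (n%:R == 0 :> K) = (n == 0)%N.
  by move/pcharf0P: K_char0 => ->.
have extL A B : (forall w, (fdeg w <= m)%N -> A w = B w) -> L A = L B.
  move=> eAB; have := contL (fun w => -1 * A w + B w); rewrite linL mulN1r.
  move/(_ _)/eqP; rewrite addrC subr_eq0 => e; apply/esym/eqP/e => w w_m.
  by rewrite eAB // mulN1r addNr.
have sumL (r : seq nat) (c : nat -> K) :
    L (fun w => \sum_(k <- r) c k * delta_bar (nseq k t) w) =
    \sum_(k <- r) c k * L (delta_bar (nseq k t)).
  elim: r => [|k r IH].
    by rewrite big_nil; apply: contL => w _; rewrite big_nil.
  rewrite big_cons -IH -linL; apply: extL => w _; exact: big_cons.
(* Words of degree at most [m] have at most [m] trees, so truncating the exponential here does not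
   change [L]; the bound [m.+2] keeps the coefficient of index 1 even if [m] is 0. *)
pose P := \poly_(k < m.+2) (L (delta_bar (nseq k t)) / k`!%:R).
have P0 a : P.[a] = 0.
  rewrite -(L0 a) horner_poly -(big_mkord xpredT
    (fun k => L (delta_bar (nseq k t)) / k`!%:R * a ^+ k)).
  under eq_bigr do rewrite -mulrA mulrC.
  rewrite -(sumL _ (fun k => k`!%:R^-1 * a ^+ k)); apply: extL => w w_m.
  rewrite /exp_tree; case: eqP => [ew|nw].
    rewrite (big_uniq_sub (t := [:: size w])) ?iota_uniq //.
    - by rewrite big_seq1 /delta_bar -ew eqxx mulr1 mulrC.
    - move=> k; rewrite inE => /eqP->; rewrite mem_index_iota /=.
      by rewrite (leq_ltn_trans (size_le_fdeg w)) // ltnS ltnW.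
    move=> k _; rewrite inE /delta_bar => kw; case: eqP => [e|]; last by rewrite mulr0.
    by rewrite e size_nseq eqxx in kw.
  rewrite big1 // => k _; rewrite /delta_bar; case: eqP => [e|]; last by rewrite mulr0.
  by case: nw; rewrite e size_nseq.
have natr_inj : injective (fun n => n%:R : K).
  have le n k : (n <= k)%N -> n%:R = k%:R :> K -> n = k.
    move=> n_k /eqP; rewrite eq_sym -subr_eq0 -natrB // natr_eq0 subn_eq0.
    by move=> k_n; apply/eqP; rewrite eqn_leq n_k.
  move=> n k; case/orP: (leq_total n k) => h; first exact: le.
  by move/esym/(le _ _ h).
have /eqP/polyP/(_ 1) : P == 0.
  apply: contraT => nP; have := max_poly_roots (rs := [seq n%:R | n <- iota 0 (size P)]) nP.
  rewrite map_inj_uniq ?iota_uniq // size_map size_iota ltnn => -> //.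
  by apply/allP => a _; rewrite /root P0.
by rewrite coef_poly coef0 /= divr1.
Qed.

(** * The relation given by the ladder *)

(** Splitting [A] between the two vertices of the ladder is unshuffling it, so the coproduct
    appears; for group-like [A] this is B (A . B A). *)
Lemma grafting_bar_ladder A (i j : C) a b :
  grafting_bar A (delta_bar [:: Node j [:: leaf j]])
    [:: Node j (rcons a (Node i b))] =
  (i == j)%:R * coproduct_bar A (a, b).
Proof.
rewrite grafting_barE (eq_bigr (fun p => delta_bar [:: Node j [:: leaf j]] p.2 *
   (A p.1 * ((i == j) * count_mem (a, b) (unshuffle p.1))%N%:R))); last first.
  move=> p _; rewrite mulrCA mulrA /delta_bar.
  case: eqP => [->|]; rewrite ?mulr0 ?mul0r // graft_ladder count_map.
  congr (_ * _%:R); case: (eqVneq i j) => [->|ij].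
    rewrite mul1n; apply: eq_count => -[a' b'].
    by rewrite /= eqseq_cons eq_Node eqseq_rcons eq_Node !eqxx andbT.
  rewrite mul0n -(count_pred0 (unshuffle p.1)); apply: eq_count => -[a' b'].
  rewrite /= eqseq_cons eq_Node eqseq_rcons eq_Node [j == i]eq_sym (negPf ij).
  by rewrite !andbF.
rewrite (sum_delta_bar (fun w => A w * ((i == j) * count_mem (a, b) (unshuffle w))%N%:R)).
  rewrite [X in forests C X](_ : _ = fdeg a + fdeg b)%N; last first.
    rewrite !fdeg_seq1 !tdeg_Node fdeg_rcons tdeg_Node fdeg_seq1 tdeg_Node.
    by rewrite addnS !subSS subn0.
  rewrite coproduct_barE mulr_sumr; apply: eq_bigr => w _ /=.
  by rewrite natrM mulrCA.
rewrite !fdeg_seq1 !tdeg_Node fdeg_rcons tdeg_Node fdeg_seq1 tdeg_Node.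
by rewrite addnS.
Qed.

(** The tree [Node j p.1] is grafted either on the root of [Node j p.2], as its first branch, or
    inside the branches [p.2]: the two summands. *)
Lemma grafting_bar_bullets A B (j : C) x : x != [::] ->
  grafting_bar (grafting_bar A (delta_bar [:: leaf j]))
    (grafting_bar B (delta_bar [:: leaf j])) [:: Node j x] =
  \sum_(p <- forest_pairs C (fdeg x).-1) A p.1 * B p.2 *
    ((Node j p.1 :: p.2 == x)%:R + (count_mem x (graft [:: Node j p.1] p.2))%:R).
Proof.
rewrite -fdeg_eq0 => x_gt0.
have degx : fdeg [:: Node j x] = (fdeg x).-1.+2.
  by rewrite fdeg_seq1 tdeg_Node prednK // lt0n.
pose f (p : forest C * forest C) := ([:: Node j p.1], [:: Node j p.2]).
rewrite grafting_barE degx.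
rewrite (big_uniq_sub (t := [seq f p | p <- forest_pairs C (fdeg x).-1])).
- rewrite big_map; apply: eq_bigr => p _.
  rewrite graft_tree1 !grafting_bar_bullet /= eqxx !mul1r; congr (_ * _).
  rewrite count_map natrD eqseq_cons eq_Node eqxx andbT.
  congr (_ + _%:R); apply: eq_count => w /=.
  by rewrite eqseq_cons eq_Node eqxx andbT.
- exact: uniq_forest_pairs.
- by rewrite map_inj_uniq ?uniq_forest_pairs // => -[? ?] [? ?] [-> ->].
- move=> _ /mapP[p + ->]; rewrite !mem_forest_pairs !fdeg_seq1 !tdeg_Node.
  by rewrite addSn addnS.
move=> [a b]; rewrite mem_forest_pairs !grafting_bar_bullet /=.
case: a b => [|[c a] [|? ?]] [|[d b] [|? ?]]; rewrite ?mul0r ?mulr0 ?mul0r //.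
have [->|_ _ _] := eqVneq c j; last by rewrite !mul0r.
have [->|_ _ _] := eqVneq d j; last by rewrite mul0r mulr0 mul0r.
move=> ab /negP[]; apply/mapP; exists (a, b) => //.
by move: ab; rewrite mem_forest_pairs !fdeg_seq1 !tdeg_Node addSn addnS.
Qed.

Lemma fdeg_eq1 w : fdeg w = 1%N -> exists c, w = [:: leaf c].
Proof.
case: w => [|[c s] w] //; rewrite fdeg_cons tdeg_Node addSn => -[] /eqP.
by rewrite addn_eq0 !fdeg_eq0 => /andP[/eqP-> /eqP->]; exists c.
Qed.

(** Strong induction on the degree n: once xi vanishes in degrees 1 to n-1, the quadratic relation
    becomes linear in the component of degree n, which is killed by decreasing number of trees. *)
Lemma group_like_eq_one (K_char0 : [pchar K] =i pred0) (xi : OFbar K C) :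
  group_like xi ->
  (forall j, grafting_bar xi (delta_bar [:: Node j [:: leaf j]]) =1
     grafting_bar (grafting_bar xi (delta_bar [:: leaf j]))
       (grafting_bar xi (delta_bar [:: leaf j]))) ->
  xi =1 @one_bar K C.
Proof.
move=> [xi1 xiM] xi_ladder.
(* The relation xi . B xi = B xi . xi + B xi |> xi, read at the forest [rcons a (Node i b)]. *)
have rel j a i b : (i == j)%:R * (xi a * xi b) =
    \sum_(p <- forest_pairs C (fdeg a + fdeg b)) xi p.1 * xi p.2 *
      ((Node j p.1 :: p.2 == rcons a (Node i b))%:R +
       (count_mem (rcons a (Node i b)) (graft [:: Node j p.1] p.2))%:R).
  rewrite -[xi a * xi b]/(tens xi xi (a, b)) -xiM -grafting_bar_ladder.
  rewrite xi_ladder grafting_bar_bullets; last by case: (a).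
  by rewrite fdeg_rcons tdeg_Node addnS.
suff xi0 n w : fdeg w = n -> w != [::] -> xi w = 0.
  by move=> w; rewrite /one_bar; have [->//|/(xi0 _ _ erefl)] := eqVneq w.
elim/ltn_ind: n w => n IHn w0 w0n w0_neq0.
have low w : (fdeg w < n)%N -> w != [::] -> xi w = 0 by move=> /IHn; apply.
(* At the tree [Node j [:: leaf j]] both terms on the right contribute, so the relation says c = c +
   c for c the coefficient of leaf j. *)
have bullet0 j : n = 1%N -> xi [:: leaf j] = 0.
  move=> n1; have := rel j [::] j [:: leaf j]; rewrite eqxx xi1 !mul1r.
  rewrite (big_uniq_sub (t := [:: ([:: leaf j], [::]); ([::], [:: leaf j])])).
  - rewrite !big_cons big_nil /= xi1 !eqxx eqseq_cons andbF addn0 !addr0 add0r.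
    rewrite !mulr1 !mul1r => /eqP; rewrite -subr_eq0 opprD addNKr oppr_eq0.
    by move/eqP.
  - exact: uniq_forest_pairs.
  - by [].
  - by move=> p; rewrite !inE mem_forest_pairs => /orP[] /eqP->.
  move=> [a b]; rewrite mem_forest_pairs !inE /= => /eqP ab_1; rewrite -[RHS]/1%N in ab_1.
  have [a0|a0] := eqVneq a [::].
    have [|c bc] := @fdeg_eq1 b; first by rewrite -ab_1 a0.
    rewrite a0 bc graft_leaf /= eqseq_cons andbF !add0r addn0 eqseq_cons eq_Node.
    rewrite xpair_eqE /= eqseq_cons eq_Node /= andbT eqxx !andbT.
    by move/negPf->; rewrite mulr0.
  have b0 : b = [::] by apply/eqP; rewrite -fdeg_eq0; move: a0 ab_1;
    rewrite -fdeg_eq0; case: (fdeg a) (fdeg b) => [|[|m]] [|k].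
  have [|c ac] := @fdeg_eq1 a; first by rewrite -ab_1 b0 addn0.
  rewrite b0 ac graft_nil_r /= xpair_eqE eqxx andbT eqseq_cons eq_Node.
  rewrite !eqseq_cons !eq_Node /= addr0 !eqxx !andbT => ij.
  by move: ij; rewrite negb_or !eqseq_cons eq_Node !andbT => /negPf->; rewrite mulr0.
(* The coproduct has coefficient (m+2) xi (leaf j ^ (m+2)) at (leaf j, leaf j ^ (m+1)), and
   group-likeness makes it a multiple of xi (leaf j), which is 0 by [low]. *)
have leaves0 j m : n = m.+2 -> xi (nseq m.+2 (leaf j)) = 0.
  move=> nm.
  have := xiM ([:: leaf j], nseq m.+1 (leaf j)); rewrite coproduct_barE /tens.
  rewrite (low [:: leaf j]) ?nm // mul0r (big_uniq_sub (t := [:: [:: leaf j] ++ nseq m.+1 (leaf j)])).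
  - have := count_unshuffle_nseq (leaf j) 1 m.+1; rewrite add1n bin1 big_seq1 => ->.
    move/eqP; rewrite mulf_eq0 => /orP[/eqP//|].
    by move/pcharf0P: K_char0 => ->.
  - exact: uniq_forests.
  - by [].
  - by move=> w; rewrite inE => /eqP->; rewrite mem_forests fdeg_cat.
  move=> w _; rewrite inE => w_nseq; rewrite (count_memPn _) ?mulr0 //.
  apply: contra w_nseq => /perm_unshuffle jw.
  have := perm_size jw; rewrite size_cat size_nseq => sz.
  have := perm_all (pred1 (leaf j)) jw.
  by rewrite all_cat all_nseq /= eqxx => /esym/all_pred1P->; rewrite -sz.
(* Downward induction on the number of trees of w. *)
have long k w : fdeg w = n -> (n < size w + k)%N -> xi w = 0.
  elim: k w => [|k IHk] w wn wk.
    by have := size_le_fdeg w; rewrite wn leqNgt -(addn0 (size w)) wk.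
  case: w wn wk => [|[j s] w] wn wk.
    by move: w0_neq0; rewrite -fdeg_eq0 w0n -wn.
  (* Take [b] empty in [rel]. If both parts of a pair are nonempty, [low] applies; an empty second
     part cannot give a forest of two or more trees. If the first part is empty, its grafting term
     needs a second part with one tree more than [t :: u], excluded by [IHk]. Only the concatenation
     of leaf j with [rcons u (leaf j)] survives. *)
  have rot t u : fdeg (t :: u) = n -> (n < size (t :: u) + k.+1)%N ->
      xi (t :: u) = (t == leaf j)%:R * xi (rcons u (leaf j)).
    move=> un uk; have := rel j (t :: u) j [::].
    rewrite eqxx xi1 mul1r mulr1 addn0 un => ->.
    rewrite big_seq (eq_bigr (fun p => (t == leaf j)%:R *
      ((p == ([::], rcons u (leaf j)))%:R * xi p.2))); last first.
      move=> [a b]; rewrite mem_forest_pairs xpair_eqE /= => /eqP ab.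
      have [->|b0] := eqVneq b [::].
        rewrite graft_nil_r eqseq_cons [[::] == _]eq_sym -size_eq0 size_rcons andbF /=.
        by rewrite addr0 andbF mul0r !mulr0.
      have [a0|a0] := eqVneq a [::]; last first.
        rewrite low ?mul0r ?mulr0 //.
        by rewrite -ab -addn1 leq_add2l lt0n fdeg_eq0.
      have [/size_graft sb|x_graft] :=
          boolP (rcons (t :: u) (Node j [::]) \in graft [:: Node j a] b).
        rewrite (IHk b) ?mulr0 ?mul0r ?mulr0 //.
          by rewrite -ab a0.
        by rewrite -sb size_rcons addSnnS.
      rewrite (count_memPn x_graft) addr0 a0 xi1 mul1r eqseq_cons /=.
      by rewrite -mulnb natrM [xi b * _]mulrC [t == _]eq_sym mulrA.
    rewrite -big_seq; case: eqP => [tj|_]; last by rewrite big1 ?mul0r // => p _; rewrite mul0r.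
    rewrite (big_uniq_sub (t := [:: ([::], rcons u (leaf j))])) ?uniq_forest_pairs //.
    - by rewrite big_seq1 eqxx !mul1r.
    - move=> p; rewrite inE => /eqP->; rewrite mem_forest_pairs.
      by rewrite -un tj fdeg_cons /= fdeg_rcons [X in _ == X]addnC.
    by move=> p _; rewrite inE => /negPf->; rewrite mul0r mulr0.
  (* Rotating w brings a tree other than leaf j to the front, where rot gives 0. *)
  have rots v m : fdeg (v ++ nseq m (leaf j)) = n ->
      (n < size (v ++ nseq m (leaf j)) + k.+1)%N ->
      ~~ all (pred1 (leaf j)) v -> xi (v ++ nseq m (leaf j)) = 0.
    elim: v m => //= t v IHv m vn vk; rewrite rot //.
    have [tj|] /= := eqVneq t (leaf j); last by rewrite mul0r.
    rewrite mul1r -cats1 -catA -(nseqD m 1) addn1 /= => nv.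
    apply: (IHv m.+1) => //.
      by rewrite -vn tj fdeg_cat !fdeg_cons fdeg_cat addnCA.
    by move: vk; rewrite !size_cat !size_nseq [(_ + m.+1)%N]addnS.
  have [/all_pred1P w_nseq|nw] := boolP (all (pred1 (leaf j)) (Node j s :: w)); last first.
    by have := rots _ 0 _ _ nw; rewrite cats0; apply.
  rewrite w_nseq /=; case sw: (size w) => [|m].
    rewrite /= bullet0 // -wn w_nseq /= sw //.
  apply: leaves0; rewrite -wn w_nseq [size _]/= sw.
  by elim: (m.+2) => // i IH; rewrite fdeg_cons IH.
by apply: (long n.+1) => //; rewrite addnS ltnS leq_addl.
Qed.
End Series.

(** * Comparison of translation and grafting *)

Theorem proposition6p8 (K : fieldType) (K_char0 : [pchar K] =i pred0)
  (C : finType)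
  (T : (C -> OFbar K C) -> OFbar K C -> OFbar K C)
  (T_translation : forall w : C -> OFbar K C,
     (forall i, primitive (w i)) -> is_translation w (T w))
  (rhoT : OF K C -> symOF K C) (rhoT_dual : dual_coaction T rhoT)
  (v : C -> OFbar K C) (v_primitive : forall i, primitive (v i))
  (xi : OFbar K C) (xi_group_like : group_like xi)
  (translation_eq_grafting : forall A : OFbar K C, group_like A ->
     forall x : OF K C,
       pairing_symOF (exp_char v) A (rhoT x) = pairing (tens xi A) (rho_graft x)) :
  [/\ exp_char v =1 @sym_one K C,
      forall i, v i =1 (fun=> 0)
    & xi =1 @one_bar K C].
Proof.
have [linT contT bulletT _ _ graftT _ _] := T_translation v v_primitive.
have T_group_like A : group_like A -> T v A =1 grafting_bar xi A.
  move=> glA x; rewrite -pairingU (rhoT_dual v v_primitive).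
  by rewrite translation_eq_grafting // -rho_graftP pairingU.
(* Series are compared pointwise; that [T v] respects this equality follows from linearity and
   continuity applied to B - A, which vanishes in every degree. *)
have extT A B : A =1 B -> T v A =1 T v B.
  move=> eAB x; have [m contTx] := contT (fdeg x).
  have := contTx (fun w => -1 * A w + B w) _ x (leqnn _).
  rewrite linT mulN1r addrC => /(_ _)/eqP; rewrite subr_eq0 => e.
  by apply/esym/eqP/e => w _; rewrite eAB mulN1r addNr.
have T_tree t : T v (delta_bar K [:: t]) =1 grafting_bar xi (delta_bar K [:: t]).
  move=> x; apply/eqP; rewrite -subr_eq0; apply/eqP.
  apply: (@exp_tree_linear_part K C K_char0
    (fun A => T v A x - grafting_bar xi A x)).
  - move=> a A B; rewrite (linT a A B x) (grafting_bar_linear xi a A B x).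
    move: (T v A x) (T v B x) (grafting_bar xi A x) (grafting_bar xi B x).
    by move=> y y' z z'; rewrite mulrBr opprD addrACA.
  - have [m contTx] := contT (fdeg x).
    have [k contx] := @grafting_bar_continuous _ _ xi (fdeg x).
    exists (maxn m k) => A A0; rewrite contTx ?contx ?subrr // => w wm.
      by rewrite A0 // leq_max wm orbT.
    by rewrite A0 // leq_max wm.
  by move=> a; rewrite T_group_like ?subrr //; exact: exp_tree_group_like.
have xi_one : xi =1 @one_bar K C.
  apply: (group_like_eq_one K_char0 xi_group_like) => j x.
  rewrite -(T_tree (Node j [:: leaf j]) x).
  pose bullet := delta_bar K [:: leaf j].
  (* The ladder is the bullet grafted on itself, which lets the morphism property of [T v] for
     grafting act. *)
  have -> : T v (delta_bar K [:: Node j [:: leaf j]]) x =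
      T v (grafting_bar bullet bullet) x.
    apply: extT => w; rewrite grafting_bar_bullet /bullet /delta_bar.
    case: w => [|[d w] [|t s]] //; rewrite !eqseq_cons eq_Node ?andbF //.
    by rewrite andbT -mulnb natrM.
  rewrite graftT; try exact: primitive_delta_bar.
  by apply: eq_grafting_bar; exact: T_tree.
have v0 i : v i =1 (fun=> 0).
  move=> w; have := T_tree (leaf i) w; rewrite bulletT.
  rewrite (eq_grafting_bar (A' := @one_bar K C) (B' := delta_bar K [:: leaf i])) //.
  rewrite grafting_bar_bullet => e; apply: (addrI (bullet_bar K i w)); rewrite e addr0.
  rewrite /bullet_bar /one_bar.
  case: w {e} => [|[d w] [|t s]] //; rewrite !eqseq_cons eq_Node ?andbF //.
  by rewrite andbT -mulnb natrM.
(* With v = 0 the exponent is the zero series, so only the term k = 0 of the exponential remains. *)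
split=> // m; rewrite /exp_char /sym_exp big_ord_recl /= big1 => [|k _].
  by rewrite fact0 invr1 mul1r addr0.
rewrite /= {1}/sym_mul big1 ?mulr0 // => p _.
rewrite big1 ?mul0r // => i _; rewrite /sym_gen.
case: (p.1) => [|[l j] [|? ?]] //; case: eqP => // _.
by rewrite /pairing big1 // => w _; rewrite v0 mul0r.
Qed.
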